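(* Let $\mathcal{H}$ be a real Hilbert space, let $s,t\in\mathbb{N}\smallsetminus\{0\}$, set $I:=\{1,\ldots,s\}$ and $J:=\{1,\ldots,t\}$, and let $\bar{x}\in\mathcal{H}$. Let $f$ and $(g_i)_{i\in I}$ be functions in $\Gamma_0(\mathcal{H})$. For every $j\in J$, let $u_j\in\mathcal{H}$, $\eta_j\in\mathbb{R}$, and set $h_j(x):=\langle u_j,x\rangle-\eta_j$ for all $x\in\mathcal{H}$. Assume that (1) for every $i\in I$, $\operatorname{lev}_{\le0}g_i\subseteq\operatorname{int}\operatorname{dom}g_i$; (2) $\left(\bigcap_{i\in I}\operatorname{lev}_{<0}g_i\right)\cap\left(\bigcap_{j\in J}\ker h_j\right)\neq\varnothing$; (3) $0\in\operatorname{sri}\left(\left(\bigcap_{i\in I}\operatorname{lev}_{\le0}g_i\right)\cap\left(\bigcap_{j\in J}\ker h_j\right)-\operatorname{dom}f\right)$. Consider the problem $$(\mathcal{P})\qquad \text{minimize } f(x)\ \text{ subject to } g_i(x)\le0\ (i\in I),\quad h_j(x)=0\ (j\in J).$$ Then $\bar{x}$ is a solution to $(\mathcal{P})$ if and only if $(\mathrm{K})$ there exist $(\bar\lambda_i)_{i\in I}\in\mathbb{R}_+^s$, $(\bar v_i)_{i\in I}\in\times_{i\in I}\partial g_i(\bar x)$ and $(\bar\beta_j)_{j\in J}\in\mathbb{R}^t$ such that $$-\sum_{i\in I}\bar\lambda_i\bar v_i-\sum_{j\in J}\bar\beta_ju_j\in\partial f(\bar x),\qquad (\forall i\in I)\ g_i(\bar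 x)\le0,\ \bar\lambda_ig_i(\bar x)=0,\qquad(\forall j\in J)\ h_j(\bar x)=0,$$ in which case $(\bar\lambda_i)_{i\in I}\times(\bar\beta_j)_{j\in J}$ are Lagrange multipliers associated with $\bar x$, and $\bar x$ solves the problem $$\min_{x\in\mathcal{H}}\ f(x)+\sum_{i\in I}\bar\lambda_ig_i(x)+\sum_{j\in J}\bar\beta_jh_j(x).$$ Moreover, if $f$ and $(g_i)_{i\in I}$ are Gâteaux differentiable at $\bar x$, then condition $(\mathrm{K})$ becomes (is equivalent to): there exist $(\bar\lambda_i)_{i\in I}\in\mathbb{R}_+^s$ and $(\bar\beta_j)_{j\in J}\in\mathbb{R}^t$ such that $$\nabla f(\bar x)+\sum_{i\in I}\bar\lambda_i\nabla g_i(\bar x)+\sum_{j\in J}\bar\beta_ju_j=0,\qquad(\forall i\in I)\ g_i(\bar x)\le0,\ \bar\lambda_ig_i(\bar x)=0,\qquad(\forall j\in J)\ h_j(\bar x)=0.$$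
   Context: $\mathbb{N}=\{0,1,2,\ldots\}$, $\mathbb{R}_+=[0,+\infty)$. $\Gamma_0(\mathcal{H})$ is the set of proper lower semicontinuous convex functions from $\mathcal{H}$ to $]-\infty,+\infty]$, and $\operatorname{dom}f=\{x: f(x)<+\infty\}$. $\operatorname{lev}_{\le0}g=\{x:g(x)\le0\}$, $\operatorname{lev}_{<0}g=\{x:g(x)<0\}$, $\ker h_j=\{x\in\mathcal{H}:h_j(x)=0\}$, and $\operatorname{int}$ is the topological interior. The subdifferential is $\partial f(x)=\{u\in\mathcal{H}:(\forall y\in\mathcal{H})\ \langle y-x,u\rangle+f(x)\le f(y)\}$. For a nonempty convex set $C\subseteq\mathcal{H}$, the strong relative interior is $\operatorname{sri}C=\{x\in C:\operatorname{cone}(C-x)=\overline{\operatorname{span}}(C-x)\}$, where $\operatorname{cone}D=\bigcup_{\lambda>0}\lambda D$ is the conical hull of $D$ and $\overline{\operatorname{span}}$ is the closed linear span. $A-B=\{a-b:a\in A,b\in B\}$. The Lagrangian is $L(x,\lambda,\beta)=f(x)+\sum_{i\in I}\lambda_ig_i(x)+\sum_{j\in J}\beta_jh_j(x)$ for $x\in\mathcal{H}$, $\lambda\in\mathbb{R}_+^s$, $\beta\in\mathbb{R}^t$, with the convention $0\cdot(+\infty)=0$. The vector $(\bar\lambda,\bar\beta)\in\mathbb{R}_+^s\times\mathbb{R}^t$ is said to consist of Lagrange multipliers associated with the solution $\bar x$ if $(\bar x,(\bar\lambda,\bar\beta))$ is a saddle point of $L$: $L(\bar x,\lambda,\beta)\le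 L(\bar x,\bar\lambda,\bar\beta)\le L(x,\bar\lambda,\bar\beta)$ for all $x\in\mathcal{H}$, $\lambda\in\mathbb{R}_+^s$, $\beta\in\mathbb{R}^t$. *)

(* Defs.v *)
From HB Require Import structures.
From mathcomp Require Import all_boot all_order all_algebra.
From mathcomp Require Import all_classical all_reals all_analysis.

Set Implicit Arguments.
Unset Strict Implicit.
Unset Printing Implicit Defensive.

Import Order.TTheory GRing.Theory Num.Theory.
Import numFieldNormedType.Exports.

Local Open Scope classical_set_scope.
Local Open Scope ring_scope.

(* A real Hilbert space is a complete normed module whose norm comes from an
   inner product ([{dot H for idfun}]: bilinear, symmetric, positive definite
   forms). *)
HB.mixin Record CompleteNormedModule_isHilbert (R : realType) H
    of CompleteNormedModule R H := {
  inner : {dot H for (@idfun R)} ;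
  inner_normE : forall x : H, inner x x = `|x| ^+ 2
}.

#[short(type="hilbertType")]
HB.structure Definition Hilbert (R : realType) :=
  {H of CompleteNormedModule_isHilbert R H & CompleteNormedModule R H}.

Section sets.
Context {R : realType} {H : hilbertType R}.
Implicit Types (A B C D : set H) (x : H).

Definition minkowski_sub A B : set H := [set a - b | a in A & b in B].

Definition cone D : set H :=
  \bigcup_(l in [set l : R | 0 < l]) [set l *: d | d in D].

Definition linear_subspace : set (set H) :=
  [set V | V 0 /\ forall (a : R) x y, V x -> V y -> V (a *: x + y)].

Definition closed_span D : set H := closure (smallest linear_subspace D).

Definition sri C : set H :=
  [set x | C x /\
    cone (minkowski_sub C [set x]) = closed_span (minkowski_sub C [set x])].

End sets.

Section functions.
Context {R : realType} {H : hilbertType R}.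
Implicit Types (f g : H -> \bar R) (x y u : H).
Local Open Scope ereal_scope.

Definition edom f : set H := [set x | f x < +oo].

Definition eproper f := (forall x, -oo < f x) /\ edom f !=set0.

(* For functions that never take the value -oo, no indeterminate sum occurs
   here, since the coefficients are positive. *)
Definition econvex f := forall (t : R) x y, (0 < t < 1)%R ->
  f (t *: x + (1 - t) *: y)%R <= t%:E * f x + (1 - t)%:E * f y.

Definition Gamma0 f := [/\ eproper f, lower_semicontinuous f & econvex f].

Definition lev_le0 g : set H := [set x | g x <= 0].
Definition lev_lt0 g : set H := [set x | g x < 0].

Definition subdiff f x : set H :=
  [set u | forall y, (inner (y - x)%R u)%:E + f x <= f y].

Definition is_minimizer f (C : set H) x :=
  C x /\ forall y, C y -> f x <= f y.

(* [D] is the directional derivative map of [f] at [x]. The limit is taken in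
   the extended reals; since [D y] is finite, its existence forces
   [f (x + a *: y)] to be finite for all small enough [a > 0]. *)
Definition is_directional_derivative f x (D : H -> R) :=
  f x \is a fin_num /\
  forall y, (f (x + a *: y)%R - f x) * (a^-1)%:E @[a --> (0:R)^'+] --> (D y)%:E.

Definition gateaux_differentiable f x :=
  exists D : {linear H -> R^o},
    continuous D /\ is_directional_derivative f x D.

(* The Riesz representer of the Gateaux derivative; a dummy value if [f] is not
   Gateaux differentiable at [x]. *)
Definition gradient f x : H :=
  xget 0%R [set u | is_directional_derivative f x (fun y => inner y u)].

End functions.

Section problem.
Context {R : realType} {H : hilbertType R} {s t : nat}.
Variables (f : H -> \bar R) (g : 'I_s -> H -> \bar R).
Variables (u : 'I_t -> H) (eta : 'I_t -> R).
Implicit Types (x : H) (lam : 'I_s -> R) (beta : 'I_t -> R) (v : 'I_s -> H).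

Definition eqconstr (j : 'I_t) (x : H) : R := inner (u j) x - eta j.

Definition ker_eqconstr (j : 'I_t) : set H := [set x | eqconstr j x = 0].

Definition feasible : set H :=
  [set x | (forall i, (g i x <= 0)%E) /\ (forall j, eqconstr j x = 0)].

(* In [\bar R], [0 * +oo = 0]. *)
Definition lagrangian x lam beta : \bar R :=
  (f x + \sum_(i < s) (lam i)%:E * g i x
       + \sum_(j < t) (beta j * eqconstr j x)%:E)%E.

Definition lagrange_multipliers xbar lam beta :=
  (forall i, 0 <= lam i) /\
  forall x lam' beta', (forall i, 0 <= lam' i) ->
    (lagrangian xbar lam' beta' <= lagrangian xbar lam beta)%E /\
    (lagrangian xbar lam beta <= lagrangian x lam beta)%E.

Definition complementary xbar lam :=
  (forall i, (g i xbar <= 0)%E /\ ((lam i)%:E * g i xbar = 0)%E) /\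
  (forall j, eqconstr j xbar = 0).

Definition KKT xbar lam v beta :=
  [/\ forall i, 0 <= lam i,
      forall i, subdiff (g i) xbar (v i),
      subdiff f xbar
        (- (\sum_(i < s) lam i *: v i) - \sum_(j < t) beta j *: u j) &
      complementary xbar lam].

Definition smooth_KKT xbar lam beta :=
  [/\ forall i, 0 <= lam i,
      gradient f xbar + \sum_(i < s) lam i *: gradient (g i) xbar
        + \sum_(j < t) beta j *: u j = 0 &
      complementary xbar lam].

End problem.

(* Main.v *)
Require Import Defs.
From HB Require Import structures.
From mathcomp Require Import all_boot all_order all_algebra.
From mathcomp Require Import all_classical all_reals all_analysis.
From mathcomp Require Import ring lra.

Set Implicit Arguments.
Unset Strict Implicit.
Unset Printing Implicit Defensive.

Import Order.TTheory GRing.Theory Num.Theory.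
Import numFieldNormedType.Exports.

Local Open Scope classical_set_scope.
Local Open Scope ring_scope.

(** The sufficiency of the Karush-Kuhn-Tucker condition is the sum of the
   subgradient inequalities of [f] and of the [g i] weighted by the multipliers:
   the linear terms cancel, which says that [xbar] minimizes the Lagrangian
   ([KKT_lagrangian_ge]).

   Necessity takes two applications of one principle, [convex_support]: a
   convex value function that is nonnegative at [0] and bounded above near [0]
   has a continuous linear minorant vanishing at [0]. This is Hahn-Banach, here
   obtained from minimal sublinear functions; the minorants on the Hilbert space
   become vectors by [riesz].

   - The first application separates the objective from the constraints
     ([attouch_brezis]). The optimal value [v z] of [f] when the feasible set [C]
     is translated by [- z] has domain [C - dom f], which by the qualification
     condition generates a closed subspace. The whole difficulty is that [v] is
     bounded above near [0] in this subspace. The differences [y - x], with [y]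
     feasible, [x] in a sublevel set of [f] and both bounded, form a convex
     absorbing subset of the subspace; it is closed by a compactness argument
     ([closed_minkowski_sub]), so that Baire's theorem makes it a neighbourhood
     of [0] ([absorbing_ball]). A subgradient of [v] at [0] is a vector [w] that
     is normal to [C] at [xbar], with [- w] a subgradient of [f].

   - The second application decomposes [w] ([normal_cone_feasible]). In the
     problem of maximizing [<., w>] over [C], shift the argument and relax the
     right-hand side of each inequality constraint independently. The Slater
     point, in the neighbourhood of which every [g i] is bounded by a negative
     constant ([slater_ball]), bounds the value function near [0]. The linear
     minorant consists of vectors [W i], dual to the shifts, and multipliers
     [lam i], dual to the relaxations, and one reads off from special
     perturbations that [W i] is [lam i] times a subgradient of [g i], and that
     [w - \sum_i W i] is orthogonal to the common kernel of the [u j], hence in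
     their span ([orthogonal_span]).

   Weak compactness is only used in the form of [nested_convex_closure]:
   decreasing bounded convex sets have a common adherent point.

   In the differentiable case, the subdifferential of a convex function reduces
   to its gradient, and the two forms of the condition coincide. *)

(** * Sublinear functions and supporting linear forms *)

Section sublinear.
Context {R : realType} {V : lmodType R}.
Implicit Types (p q : V -> R) (K E : V -> R -> Prop) (a b c t r : R).

Definition sublinear p :=
  (forall x y, p (x + y) <= p x + p y) /\
  (forall a x, 0 < a -> p (a *: x) <= a * p x).

Lemma sublinear0 p : sublinear p -> p 0 = 0.
Proof.
move=> [pD pZ]; apply/eqP; rewrite eq_le; apply/andP; split.
  have := pZ 2^-1 0; rewrite scaler0 => /(_ ltac:(lra)); lra.
by have := pD 0 0; rewrite addr0; lra.
Qed.

Lemma sublinear_oppr p x : sublinear p -> - p (- x) <= p x.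
Proof.
by move=> sp; have := sp.1 x (- x); rewrite subrr sublinear0//; lra.
Qed.

Definition convex_cone K :=
  [/\ K 0 0,
      forall x y a b, K x a -> K y b -> K (x + y) (a + b) &
      forall t x a, 0 < t -> K x a -> K (t *: x) (t * a)].

(** Infimal convolution of [p] with the convex cone [K] seen as an epigraph: the
   largest sublinear function below [p] whose epigraph contains [K]. *)
Definition cone_inf p K (x : V) : R :=
  inf [set r | exists e b, K e b /\ r = p (x - e) + b].

Lemma cone_inf_spec p K : sublinear p -> convex_cone K ->
  (forall e b, K e b -> 0 <= p (- e) + b) ->
  [/\ sublinear (cone_inf p K), forall x, cone_inf p K x <= p x &
      forall e b, K e b -> cone_inf p K e <= b].
Proof.
move=> sp [K0 KD KZ] Kp.
have lb x e b : K e b -> - p (- x) <= p (x - e) + b.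
  move=> /Kp; have := sp.1 (x - e) (- x).
  by rewrite addrAC subrr sub0r; lra.
have le x e b : K e b -> cone_inf p K x <= p (x - e) + b.
  move=> Keb; apply: ge_inf; last by exists e, b.
  by exists (- p (- x)) => _ [e' [b' [K' ->]]]; exact: lb.
have ge x c : (forall e b, K e b -> c <= p (x - e) + b) -> c <= cone_inf p K x.
  move=> h; apply: lb_le_inf; first by exists (p (x - 0) + 0), 0, 0.
  by move=> _ [e [b [Keb ->]]]; exact: h.
have leD x y : cone_inf p K (x + y) <= cone_inf p K x + cone_inf p K y.
  rewrite -lerBlDr; apply: (ge x) => e b Keb.
  rewrite lerBlDr -lerBlDl; apply: ge => e' b' Keb'.
  have := le (x + y) _ _ (KD _ _ _ _ Keb Keb').
  have := sp.1 (x - e) (y - e').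
  by rewrite addrACA -opprD; lra.
split=> [|x|e b Keb].
- split=> // a x a0; rewrite mulrC -ler_pdivrMr//; apply: ge => e b Keb.
  rewrite ler_pdivrMr// mulrC; apply: le_trans (le _ _ _ (KZ _ _ _ a0 Keb)) _.
  by have := sp.2 _ (x - e) a0; rewrite scalerBr mulrDr lerD2r.
- by have := le x _ _ K0; rewrite subr0 addr0.
- by have := le e _ _ Keb; rewrite subrr sublinear0// add0r.
Qed.

(** Lowering a sublinear [q] along the ray through [- z], at slope [- q z],
   yields a sublinear function below [q]; minimality forces the two to agree,
   that is [q (x + z) = q x + q z]. *)
Lemma minimal_sublinear_additive q : sublinear q ->
  (forall q', sublinear q' -> (forall x, q' x <= q x) -> q' = q) ->
  forall x z, q (x + z) = q x + q z.
Proof.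
move=> sq qmin x z.
pose K (e : V) b := exists2 t, 0 <= t & e = - (t *: z) /\ b = - (t * q z).
have cK : convex_cone K.
  split.
  - by exists 0 => //; rewrite scale0r mul0r !oppr0.
  - move=> _ _ _ _ [t t0 [-> ->]] [r r0 [-> ->]]; exists (t + r).
      exact: addr_ge0.
    by rewrite scalerDl mulrDl !opprD.
  - move=> r _ _ r0 [t t0 [-> ->]]; exists (r * t); first by rewrite mulr_ge0// ltW.
    by rewrite scalerN mulrN scalerA mulrA.
have Kq e b : K e b -> 0 <= q (- e) + b.
  move=> [t t0 [-> ->]]; rewrite opprK subr_ge0.
  have [->|t0'] := eqVneq t 0; first by rewrite mul0r scale0r sublinear0.
  have tp : 0 < t by rewrite lt_def t0'.
  rewrite mulrC -ler_pdivlMr// mulrC.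
  have := sq.2 t^-1 (t *: z); rewrite invr_gt0 scalerA mulVf// scale1r.
  exact.
have [s1 s2 s3] := cone_inf_spec sq cK Kq.
have e := qmin _ s1 s2; apply/eqP; rewrite eq_le sq.1 /=.
have : q (- z) <= - q z.
  by rewrite -{1}e; apply: s3; exists 1 => //; rewrite scale1r mul1r.
have := sq.1 (x + z) (- z); rewrite addrK; lra.
Qed.

(** Additivity turns the inequality [p (a *: x) <= a * p x] for [- x] into the
   reverse inequality for [x]. *)
Lemma sublinear_additive_linear q : sublinear q ->
  (forall x z, q (x + z) = q x + q z) -> linear (q : V -> R^o).
Proof.
move=> sq qD.
have qN x : q (- x) = - q x.
  by have := qD x (- x); rewrite subrr sublinear0//; lra.
have qZp a x : 0 < a -> q (a *: x) = a * q x.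
  move=> a0; apply/eqP; rewrite eq_le sq.2//=.
  by have := sq.2 _ (- x) a0; rewrite scalerN !qN; lra.
move=> a x y; rewrite qD; congr (_ + _).
have [a0|a0|<-] := ltgtP 0 a; first exact: qZp.
  rewrite -[a]opprK scaleNr qN qZp ?oppr_gt0// -mulNr opprK//.
by rewrite !scale0r sublinear0.
Qed.

(** Hahn-Banach: by Zorn's lemma there is a minimal sublinear function below
   [p], since the pointwise infimum of a chain of them stays sublinear. *)
Lemma exists_linear_le p : sublinear p ->
  exists L : {linear V -> R^o}, forall x, L x <= p x.
Proof.
move=> sp.
pose T := {q : V -> R | sublinear q /\ forall x, q x <= p x}.
pose rel (q1 q2 : T) := `[< forall x, sval q2 x <= sval q1 x >].
have [|||A tA|[q [sq qp]] qmax] := @Zorn T rel.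
- by move=> q; apply/asboolP.
- move=> q1 q2 q3 /asboolP h1 /asboolP h2; apply/asboolP => x.
  exact: le_trans (h2 x) (h1 x).
- move=> [q1 s1] [q2 s2] /asboolP/= h1 /asboolP/= h2.
  apply: eq_exist; apply/funext => x; apply/eqP; rewrite eq_le.
  by rewrite h1 h2.
- have [[q0 Aq0]|A0] := pselect (A !=set0); last first.
    exists (exist _ p (conj sp (fun x => lexx _))) => q Aq.
    by exfalso; apply: A0; exists q.
  pose m x := inf [set sval q x | q in A].
  have lb (q : T) x : - p (- x) <= sval q x.
    case: q => q [sq qp] /=; apply: le_trans (sublinear_oppr _ sq).
    by rewrite lerN2.
  have le (q : T) x : A q -> m x <= sval q x.
    move=> Aq; apply: ge_inf; last by exists q.
    by exists (- p (- x)) => _ [r _ <-].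
  have ge x c : (forall q : T, A q -> c <= sval q x) -> c <= m x.
    move=> h; apply: lb_le_inf; first by exists (sval q0 x), q0.
    by move=> _ [q Aq <-]; exact: h.
  have sm : sublinear m /\ forall x, m x <= p x.
    split=> [|x]; last exact: le_trans (le _ _ Aq0) ((svalP q0).2 x).
    split=> [x y|a x a0].
      rewrite -lerBlDr; apply: (ge x) => q Aq.
      rewrite lerBlDr -lerBlDl; apply: ge => r Ar.
      have [/asboolP h|/asboolP h] := tA _ _ Aq Ar.
        have := le _ (x + y) Ar; have := (svalP r).1.1 x y; have := h x; lra.
      have := le _ (x + y) Aq; have := (svalP q).1.1 x y; have := h y; lra.
    rewrite mulrC -ler_pdivrMr//; apply: ge => q Aq; rewrite ler_pdivrMr// mulrC.
    exact: le_trans (le _ _ Aq) ((svalP q).1.2 a x a0).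
  by exists (exist _ m sm) => q Aq; apply/asboolP => x; exact: le.
have qadd : forall x z, q (x + z) = q x + q z.
  apply: minimal_sublinear_additive => // q' s' q'q.
  have h x : q' x <= p x by exact: le_trans (q'q x) (qp x).
  suff /(congr1 sval) : exist _ q' (conj s' h) = exist _ q (conj sq qp) :> T by [].
  by apply: qmax; apply/asboolP.
have lq := sublinear_additive_linear sq qadd.
pose Lq := GRing.isLinear.Build R V R^o *:%R (q : V -> R^o) lq.
pose L : {linear V -> R^o} := HB.pack (q : V -> R^o) Lq.
by exists L.
Qed.

Definition convex_rel E := forall x y a b t,
  0 < t < 1 -> E x a -> E y b -> E (t *: x + (1 - t) *: y) (t * a + (1 - t) * b).

Definition cone_hull E (x : V) (a : R) :=
  exists t y b, [/\ 0 < t, E y b, x = t *: y & a = t * b].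

Lemma cone_hull_convex E :
  convex_rel E -> E 0 0 -> convex_cone (cone_hull E).
Proof.
move=> cE E0; split.
- by exists 1, 0, 0; rewrite scaler0 mulr0.
- move=> _ _ _ _ [t [x [a [t0 Ex -> ->]]]] [r [y [b [r0 Ey -> ->]]]].
  have tr0 : 0 < t + r by exact: addr_gt0.
  have trn0 : t + r != 0 by rewrite gt_eqF.
  exists (t + r), ((t / (t + r)) *: x + (1 - t / (t + r)) *: y),
    (t / (t + r) * a + (1 - t / (t + r)) * b); split=> //.
  + apply: cE => //; rewrite divr_gt0//= ltr_pdivrMr// mul1r; lra.
  + rewrite scalerDr !scalerA; congr (_ *: _ + _ *: _); by field.
  + by field.
- move=> t _ _ t0 [r [y [b [r0 Ey -> ->]]]]; exists (t * r), y, b.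
  by rewrite scalerA mulrA mulr_gt0.
Qed.

(** Here [E] stands for the epigraph of a convex value function. Averaging a
   point of [E] with a small point in the opposite direction, where the value
   function is at most [n], bounds the value function below by a negative
   multiple of the seminorm [nu]; Hahn-Banach then applies to the infimal
   convolution of this multiple with the cone generated by [E]. The hypothesis
   only concerns directions opposite to those of [E], so that [E] may live in a
   proper subspace of [V]. *)
Lemma convex_support (nu : V -> R) E n r :
  (forall x y, nu (x + y) <= nu x + nu y) ->
  (forall a x, nu (a *: x) = `|a| * nu x) ->
  0 < r -> convex_rel E -> E 0 0 -> (forall b, E 0 b -> 0 <= b) ->
  (forall e b t, E e b -> 0 < t -> nu (t *: e) <= r -> E (- (t *: e)) n) ->
  exists2 L : {linear V -> R^o},
    (exists M, forall x, L x <= M * nu x) & forall e b, E e b -> L e <= b.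
Proof.
move=> nuD nuZ r0 cE E00 E0 En.
have nu0 : nu 0 = 0 by rewrite -(scale0r 0) nuZ normr0 mul0r.
have nuN x : nu (- x) = nu x by rewrite -scaleN1r nuZ normrN1 mul1r.
have nu_ge0 x : 0 <= nu x by have := nuD x (- x); rewrite subrr nu0 nuN; lra.
have n0 : 0 <= n.
  apply: E0; have := En 0 0 1 E00 ltr01; rewrite scaler0 oppr0 nu0.
  by apply; exact: ltW.
(* [0] is a convex combination of [e] and [- (t *: e)]. *)
have balance e b t : E e b -> 0 < t -> nu (t *: e) <= r -> 0 <= t * b + n.
  move=> Eeb t0 /(En _ _ _ Eeb t0) E'.
  have t1 : 0 < 1 + t by lra.
  have t1n : 1 + t != 0 by rewrite gt_eqF.
  have := cE _ _ _ _ (t / (1 + t)) _ Eeb E'.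
  rewrite (_ : _ + _ *: - _ = 0); last first.
    rewrite scalerN scalerA -scalerBl (_ : _ - _ = 0) ?scale0r//; by field.
  rewrite divr_gt0//= ltr_pdivrMr// mul1r ltrDr => /(_ (ltac:(lra)))/E0.
  rewrite (_ : _ + _ = (t * b + n) / (1 + t)); last by field.
  by rewrite pmulr_lge0// invr_gt0.
have Elb e b : E e b -> 0 <= n / r * nu e + b.
  move=> Eeb; have := nu_ge0 e; rewrite le_eqVlt => /predU1P[e0|e0].
    rewrite -e0 mulr0 add0r leNgt; apply/negP => b0.
    (* This [t] makes [t * b + n] equal to [- 1]. *)
    have t0 : 0 < (n + 1) / - b by apply: divr_gt0; lra.
    have := balance _ _ _ Eeb t0; rewrite nuZ -e0 mulr0 => /(_ (ltW r0)).
    rewrite invrN mulrN mulNr divfK ?lt_eqF//; lra.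
  have t0 : 0 < r / nu e by exact: divr_gt0.
  have := balance _ _ _ Eeb t0.
  rewrite nuZ gtr0_norm// divfK ?gt_eqF// => /(_ (lexx _)).
  rewrite (_ : n / r * nu e + b = nu e / r * (r / nu e * b + n)).
    by rewrite pmulr_rge0// divr_gt0.
  by field; rewrite !gt_eqF.
have sp : sublinear (fun x => n / r * nu x).
  split=> [x y|a x a0].
    by rewrite -mulrDr ler_wpM2l// divr_ge0// ltW.
  by rewrite nuZ gtr0_norm// mulrCA.
have Kp e b : cone_hull E e b -> 0 <= n / r * nu (- e) + b.
  move=> [t [x [a [t0 Ex -> ->]]]].
  by rewrite nuN nuZ gtr0_norm// mulrCA -mulrDr pmulr_rge0//; exact: Elb.
have [s1 s2 s3] := cone_inf_spec sp (cone_hull_convex cE E00) Kp.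
have [L Lp] := exists_linear_le s1; exists L.
  by exists (n / r) => x; exact: le_trans (Lp x) (s2 x).
move=> e b Eeb; apply: le_trans (Lp e) (s3 _ _ _).
by exists 1, e, b; rewrite scale1r mul1r.
Qed.

End sublinear.

(** * Baire's theorem in a closed set *)

Section metric.
Context {R : realType} {H : completeNormedModType R}.
Implicit Types (A S V : set H) (x y z : H) (e r t : R).

Definition convex A :=
  forall x y (t : R), 0 < t < 1 -> A x -> A y -> A (t *: x + (1 - t) *: y).

Lemma closureP A x :
  closure A x <-> forall e, 0 < e -> exists2 a, A a & `|x - a| < e.
Proof.
split=> [cA e e0|h B /nbhs_ballP[e e0 xB]].
  have [|a [Aa xa]] := cA (ball x e); first exact: nbhsx_ballx.
  by exists a => //; move: xa; rewrite -ball_normE.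
have [a Aa xa] := h e e0; exists a; split=> //.
by apply: xB; rewrite -ball_normE.
Qed.

Lemma cauchy_limit (x : nat -> H) :
  (forall e, 0 < e -> exists N, forall n m, (N <= n)%N -> (N <= m)%N ->
    `|x n - x m| < e) ->
  exists l, forall e, 0 < e -> exists N, forall n, (N <= n)%N -> `|l - x n| < e.
Proof.
move=> xC.
have /cauchy_cvgP/cvg_ex[l xl] : cauchy (x @ \oo).
  apply: cauchy_exP => e /xC[N xN]; exists (x N), N => // n /= Nn.
  by rewrite -ball_normE; exact: xN.
exists l => e e0; move/cvgrPdist_lt: xl => /(_ e e0)[N _ lN].
by exists N => n; exact: lN.
Qed.

(** Baire's theorem in the complete space [V], by nested balls: were no [T n]
   to contain a ball of [V], one could keep shrinking balls centred in [V] so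
   that the [n]-th one avoids [T n], and the limit of the centres would lie in
   none of the [T n]. *)
Lemma closed_cover_ball V (T : nat -> set H) : closed V -> V !=set0 ->
  (forall n, closed (T n)) -> (forall z, V z -> exists n, T n z) ->
  exists n c r, [/\ V c, 0 < r & forall z, V z -> `|z - c| < r -> T n z].
Proof.
move=> clV [v0 Vv0] clT cover; apply: contrapT => noball.
pose B := {p : H * R | V p.1 /\ 0 < p.2}.
(* The ball [q] lies in the ball [p], has at most half its radius, and avoids
   [T n]. *)
pose shrink n (p q : B) :=
  [/\ `|(sval q).1 - (sval p).1| + (sval q).2 <= (sval p).2,
      (sval q).2 <= (sval p).2 / 2 &
      forall z, `|z - (sval q).1| <= (sval q).2 -> ~ T n z].
have step n p : exists q, shrink n p q.
  case: p => -[c r] [/= Vc r0].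
  have [z [Vz zc nTz]] : exists z, [/\ V z, `|z - c| < r & ~ T n z].
    apply: contrapT => h; apply: noball; exists n, c, r; split=> // z Vz zc.
    by apply: contrapT => nT; apply: h; exists z.
  have [e e0 eT] : exists2 e, 0 < e & forall y, `|z - y| < e -> ~ T n y.
    apply: contrapT => h; apply: nTz; apply: clT; apply/closureP => e e0.
    apply: contrapT => h'; apply: h; exists e => // y zy Ty.
    by apply: h'; exists y.
  pose q := Num.min (e / 2) (Num.min (r / 2) (r - `|z - c|)).
  have q0 : 0 < q by rewrite !lt_min !divr_gt0//= subr_gt0.
  have [q1 [q2 q3]] : q <= e / 2 /\ q <= r / 2 /\ q <= r - `|z - c|.
    by rewrite !ge_min !lexx !orbT.
  exists (exist _ (z, q) (conj Vz q0)); split=> /=; [lra|by []|].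
  by move=> y yz; apply: eT; rewrite distrC; lra.
pose next n p := sval (cid (step n p)).
have nextP n p : shrink n p (next n p) by exact: svalP (cid (step n p)).
pose p := fix p n := if n is m.+1 then next m (p m)
                     else exist _ (v0, 1) (conj Vv0 ltr01) : B.
pose c n := (sval (p n)).1; pose r n := (sval (p n)).2.
have r_gt0 n : 0 < r n by exact: (svalP (p n)).2.
have pS n : shrink n (p n) (p n.+1) by exact: nextP.
have cr n k : `|c (n + k)%N - c n| + r (n + k)%N <= r n.
  elim: k => [|k IH]; first by rewrite addn0 subrr normr0 add0r.
  rewrite addnS; have [+ _ _] := pS (n + k)%N.
  rewrite -/(c _) -/(c _.+1) -/(r _) -/(r _.+1).
  by have := ler_distD (c (n + k)%N) (c (n + k).+1) (c n); lra.
have r_small n : r n * n.+1%:R <= 1.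
  have : r n * 2 ^+ n <= 1.
    elim: n => [|n IH]; first by rewrite mulr1.
    have [_ + _] := pS n; rewrite -/(r _) -/(r _.+1) => h.
    apply: le_trans IH; rewrite exprS mulrA ler_wpM2r ?exprn_ge0//; lra.
  apply: le_trans; apply: ler_wpM2l; first exact: ltW.
  by have := ltn_expl n (ltnSn 1); rewrite -(ler_nat R) natrX.
have [|l cl] := @cauchy_limit c.
  move=> e e0; have [N eN] : exists N : nat, r N < e / 2.
    exists (Num.truncn (2 / e)).
    have := r_small (Num.truncn (2 / e)); have := r_gt0 (Num.truncn (2 / e)).
    have := truncnS_gt (2 / e).
    set k := _.+1%:R; set q := r _ => ek q0 qk.
    rewrite ltr_pdivrMr// in ek; rewrite ltr_pdivlMr//; nra.
  exists N => n m Nn Nm.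
  have := cr N (n - N)%N; have := cr N (m - N)%N; rewrite !subnKC//.
  have := r_gt0 n; have := r_gt0 m.
  have := ler_distD (c N) (c n) (c m); rewrite (distrC (c N)); lra.
have Vl : V l.
  apply: clV; apply/closureP => e /cl[N lN]; exists (c N); last exact: lN.
  exact: (svalP (p N)).1.
have lc n : `|l - c n| <= r n.
  rewrite leNgt; apply/negP => lt.
  have /cl[N lN] : 0 < `|l - c n| - r n by rewrite subr_gt0.
  have := lN _ (leq_addl n N); have := cr n N; have := r_gt0 (n + N)%N.
  have := ler_distD (c (n + N)%N) l (c n); lra.
have [n Tn] := cover _ Vl.
by have [_ _ /(_ l (lc n.+1))] := pS n.
Qed.

End metric.

(** * Hilbert spaces *)

Section hilbert.
Context {R : realType} {H : hilbertType R}.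
Implicit Types (A S V : set H) (x y z w : H) (e r t : R).

Lemma innerC x y : inner x y = inner y x.
Proof. by rewrite hermC expr0 mul1r. Qed.

Lemma innerDr x y z : inner x (y + z) = inner x y + inner x z.
Proof. exact: linearDr. Qed.

Lemma innerDl x y z : inner (y + z) x = inner y x + inner z x.
Proof. exact: linearDl. Qed.

Lemma innerZr t x y : inner x (t *: y) = t * inner x y.
Proof. exact: linearZr_LR. Qed.

Lemma innerZl t x y : inner (t *: y) x = t * inner y x.
Proof. exact: linearZl_LR. Qed.

Lemma innerNr x y : inner x (- y) = - inner x y.
Proof. exact: linearNr. Qed.

Lemma innerNl x y : inner (- y) x = - inner y x.
Proof. exact: linearNl. Qed.

Lemma innerBr x y z : inner x (y - z) = inner x y - inner x z.
Proof. exact: linearBr. Qed.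

Lemma innerBl x y z : inner (y - z) x = inner y x - inner z x.
Proof. exact: linearBl. Qed.

Lemma inner0r x : inner x 0 = 0.
Proof. exact: linear0r. Qed.

Lemma inner0l x : inner 0 x = 0.
Proof. exact: linear0l. Qed.

Definition innerE := (innerDr, innerDl, innerZr, innerZl, innerNr, innerNl,
  inner0r, inner0l).

Lemma inner_sumr (I : Type) (s : seq I) (F : I -> H) x :
  inner x (\sum_(i <- s) F i) = \sum_(i <- s) inner x (F i).
Proof. exact: linear_sumr. Qed.

Lemma inner_eq0 x : (forall y, inner y x = 0) -> x = 0.
Proof.
move=> /(_ x); rewrite inner_normE => /eqP.
by rewrite sqrf_eq0 normr_eq0 => /eqP.
Qed.

Lemma parallelogram x y :
  `|x - y| ^+ 2 = 2 * `|x| ^+ 2 + 2 * `|y| ^+ 2 - `|x + y| ^+ 2.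
Proof. by rewrite -!inner_normE !innerE (innerC y x); ring. Qed.

Lemma normD_sqr x y : `|x + y| ^+ 2 = `|x| ^+ 2 + 2 * inner x y + `|y| ^+ 2.
Proof. by rewrite -!inner_normE !innerE (innerC y x); ring. Qed.

(** Cauchy-Schwarz, by expanding the square of [`|y| *: x - `|x| *: y]. *)
Lemma inner_le_norm x y : inner x y <= `|x| * `|y|.
Proof.
have [->|x0] := eqVneq x 0; first by rewrite inner0l normr0 mul0r.
have [->|y0] := eqVneq y 0; first by rewrite inner0r normr0 mulr0.
have xy0 : 0 < `|x| * `|y| by rewrite mulr_gt0 ?normr_gt0.
have := sqr_ge0 (`| `|y| *: x - `|x| *: y|).
rewrite -inner_normE !innerE !inner_normE (innerC y x).
rewrite (_ : _ + _ = 2 * (`|x| * `|y|) * (`|x| * `|y| - inner x y)); last by ring.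
by rewrite pmulr_rge0 ?subr_ge0// mulr_gt0.
Qed.

Lemma norm_inner_le x y : `|inner x y| <= `|x| * `|y|.
Proof.
rewrite ler_norml inner_le_norm andbT lerNl -innerNl.
by apply: le_trans (inner_le_norm _ _) _; rewrite normrN.
Qed.

(** Points of almost minimal norm in the successive sets form a Cauchy sequence:
   their midpoints stay in the sets, so the parallelogram identity bounds the
   distances by the variation of the minimal norms, which increase to a finite
   limit. *)
Lemma nested_convex_closure (A : nat -> set H) r :
  (forall n m, (n <= m)%N -> A m `<=` A n) -> (forall n, convex (A n)) ->
  (forall n, A n !=set0) -> (forall n x, A n x -> `|x| <= r) ->
  exists a, forall n, closure (A n) a.
Proof.
move=> Amono cA A0 Ar.
pose d n := inf [set `|x| ^+ 2 | x in A n].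
have dle n x : A n x -> d n <= `|x| ^+ 2.
  move=> Anx; apply: ge_inf; last by exists x.
  by exists 0 => _ [y _ <-]; exact: sqr_ge0.
have dmono n m : (n <= m)%N -> d n <= d m.
  move=> nm; apply: lb_le_inf.
    by have [x Amx] := A0 m; exists (`|x| ^+ 2), x.
  by move=> _ [x Amx <-]; apply: dle; exact: Amono Amx.
pose D := sup (range d).
have dD n : d n <= D.
  apply: ub_le_sup; last by exists n.
  exists (r ^+ 2) => _ [m _ <-]; have [x Amx] := A0 m.
  apply: le_trans (dle _ _ Amx) _; rewrite lerXn2r ?nnegrE//; last exact: Ar Amx.
  exact: le_trans (normr_ge0 x) (Ar _ _ Amx).
have approx e : 0 < e -> exists N, forall n, (N <= n)%N -> D - e < d n.
  move=> e0; have [|_ [N _ <-] DN] := @sup_adherent _ (range d) e e0.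
    split; first by exists (d 0), 0.
    by exists D => _ [n _ <-].
  by exists N => n Nn; exact: lt_le_trans DN (dmono _ _ Nn).
have near_min n : exists a, A n a /\ `|a| ^+ 2 < d n + n.+1%:R^-1.
  have [||_ [a Aa <-] an] := @inf_adherent _ [set `|x| ^+ 2 | x in A n] n.+1%:R^-1.
  - by rewrite invr_gt0.
  - split; first by have [x Ax] := A0 n; exists (`|x| ^+ 2), x.
    by exists 0 => _ [y _ <-]; exact: sqr_ge0.
  - by exists a.
pose a n := sval (cid (near_min n)).
have aP n : A n (a n) /\ `|a n| ^+ 2 < d n + n.+1%:R^-1.
  exact: svalP (cid (near_min n)).
have [|l al] := @cauchy_limit _ _ a.
  move=> e e0; pose dl := e ^+ 2 / 8.
  have dl0 : 0 < dl by rewrite divr_gt0// exprn_gt0.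
  have [N1 DN] := approx _ dl0.
  pose N2 := Num.truncn dl^-1.
  exists (maxn N1 N2) => n m; rewrite !geq_max => /andP[N1n N2n] /andP[N1m N2m].
  have small k : (N2 <= k)%N -> k.+1%:R^-1 < dl.
    move=> N2k; rewrite invf_plt ?posrE//; apply: lt_le_trans (truncnS_gt _) _.
    by rewrite ler_nat.
  wlog nm : n m N1n N2n N1m N2m / (n <= m)%N.
    move=> W; have [nm|/ltnW mn] := leqP n m; first exact: W.
    by rewrite distrC; exact: W.
  have [Ana an] := aP n; have [Ama am] := aP m.
  have h2 : 0 < (2^-1 : R) < 1 by apply/andP; split; lra.
  have mid : d n <= `|2^-1 *: (a n + a m)| ^+ 2.
    apply: dle; have := cA n _ _ _ h2 Ana (Amono _ _ nm _ Ama).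
    by rewrite (_ : 1 - 2^-1 = 2^-1) ?scalerDr//; lra.
  rewrite normrZ exprMn gtr0_norm ?invr_gt0// in mid.
  rewrite -(@ltr_pXn2r _ 2) ?nnegrE//; last exact: ltW.
  rewrite parallelogram.
  have := DN _ N1n; have := dD m; have := small _ N2n; have := small _ N2m.
  move: mid an am; set u := `|a n + a m| ^+ 2.
  have e20 : 0 < e ^+ 2 by rewrite exprn_gt0.
  by move: n.+1%:R^-1 m.+1%:R^-1 => u1 u2; rewrite /dl; lra.
exists l => n; apply/closureP => e /al[N lN]; exists (a (maxn n N)).
  by apply: Amono (aP _).1; exact: leq_maxl.
by apply: lN; exact: leq_maxr.
Qed.

Lemma normr_cvx x y t :
  `|t *: x + (1 - t) *: y| ^+ 2 =
  t * `|x| ^+ 2 + (1 - t) * `|y| ^+ 2 - t * (1 - t) * `|x - y| ^+ 2.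
Proof. by rewrite -!inner_normE !innerE (innerC y x); ring. Qed.

(** The representer minimizes [`|z|^2 - 2 L z]. The minimum is attained because
   the sets of almost minimizers are convex, bounded and decreasing, so that
   they have a common adherent point. *)
Lemma riesz (L : {linear H -> R^o}) (M : R) :
  (forall x, L x <= M * `|x|) -> exists w, forall x, L x = inner x w.
Proof.
move=> LM; pose l x : R := L x.
have lD x y : l (x + y) = l x + l y by rewrite /l linearD.
have lZ t x : l (t *: x) = t * l x by rewrite /l linearZ.
have l0 : l 0 = 0 by rewrite /l linear0.
have lM x : l x <= M * `|x| by exact: LM.
suff [w lw] : exists w, forall x, l x = inner x w by exists w.
move: l lD lZ l0 lM => {LM}l lD lZ l0 lM.
pose J z : R := `|z| ^+ 2 - 2 * l z.
have J_lb z : - M ^+ 2 <= J z.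
  by have := lM z; have := sqr_ge0 (`|z| - M); rewrite /J sqrrB; nra.
pose m := inf (range J).
have mJ z : m <= J z.
  by apply: ge_inf; [exists (- M ^+ 2) => _ [y _ <-]|exists z].
pose A n := [set z | J z < m + n.+1%:R^-1].
have [|||n z|a aA] := @nested_convex_closure A (`|M| + m + M ^+ 2 + 2).
- move=> n k nk z /lt_le_trans; apply; rewrite lerD2l lef_pV2 ?posrE//.
  by rewrite ler_nat.
- move=> n x y t /andP[t0 t1]; rewrite /A /= /J => Ax Ay.
  rewrite normr_cvx lD !lZ.
  have : 0 <= t * (1 - t) * `|x - y| ^+ 2.
    by rewrite mulr_ge0 ?sqr_ge0// mulr_ge0//; lra.
  have h1 : 0 < (1 - t) * (m + n.+1%:R^-1 - (`|y| ^+ 2 - 2 * l y)).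
    by rewrite mulr_gt0// subr_gt0.
  have h2 : 0 < t * (m + n.+1%:R^-1 - (`|x| ^+ 2 - 2 * l x)).
    by rewrite mulr_gt0// subr_gt0.
  have arith (k a b X Y q : R) : 0 < (1 - t) * (k - (Y - 2 * b)) ->
      0 < t * (k - (X - 2 * a)) -> 0 <= q ->
    t * X + (1 - t) * Y - q - 2 * (t * a + (1 - t) * b) < k by lra.
  exact: arith h1 h2.
- move=> n; have [|| _ [z _ <-] mz] := @inf_adherent _ (range J) n.+1%:R^-1.
  + by rewrite invr_gt0.
  + by split; [exists (J 0), 0|exists (- M ^+ 2) => _ [y _ <-]].
  + by exists z.
- rewrite /A /= /J => Az.
  have n1 : n.+1%:R^-1 <= 1 :> R by rewrite invf_le1// ler1n.
  have mM : - M ^+ 2 <= m.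
    by apply: lb_le_inf; [exists (J 0), 0|move=> _ [y _ <-]].
  have arith (k a X : R) : X ^+ 2 - 2 * a < m + k -> k <= 1 -> a <= M * X ->
      X - M <= m + M ^+ 2 + 2.
    move=> h1 h2 h3; rewrite leNgt; apply/negP => h4.
    have h5 : (X - M) ^+ 2 <= m + 1 + M ^+ 2 by rewrite sqrrB; lra.
    by nra.
  have := arith _ _ _ Az n1 (lM z); have := ler_norm M; lra.
have Ja : J a <= m.
  apply/ler_addgt0Pr => e e0.
  pose C := 2 * `|a| + 1 + 2 * `|M|.
  have C0 : 0 < C by rewrite /C; have := normr_ge0 a; have := normr_ge0 M; lra.
  pose n := Num.truncn (2 / e).
  pose dl := Num.min 1 (e / 2 / C).
  have dl0 : 0 < dl by rewrite lt_min ltr01 !divr_gt0.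
  have [z Az az] := (closureP _ _).1 (aA n) dl dl0.
  have [az1 az2] : `|a - z| < 1 /\ `|a - z| * C < e / 2.
    by move: az; rewrite lt_min => /andP[-> /=]; rewrite ltr_pdivlMr.
  have n1 : n.+1%:R^-1 < e / 2.
    by rewrite invf_plt ?posrE ?divr_gt0// invf_div truncnS_gt.
  have lMz : l z - l a <= M * `|a - z|.
    by have := lM (z - a); rewrite distrC lD -scaleN1r lZ mulN1r.
  have := ler_norm M; have := ler_distD 0 a z; have := ler_distD a 0 z.
  rewrite !subr0 !sub0r !normrN => t1 t2 t3; move: Az; rewrite /A /= /J => Az.
  have zz := ler_distD z a 0; rewrite !subr0 in zz.
  have : `|a| ^+ 2 - `|z| ^+ 2 <= `|a - z| * (2 * `|a| + 1).
    by rewrite subr_sqr; have := normr_ge0 a; have := normr_ge0 z; nra.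
  move=> sq; have MM : M * `|a - z| <= `|M| * `|a - z| by rewrite ler_wpM2r.
  have arith (k d N Md X Z la lz : R) : X - Z <= d * (2 * `|a| + 1) ->
      d * (2 * `|a| + 1 + 2 * N) < e / 2 -> k < e / 2 -> Z - 2 * lz < m + k ->
      lz - la <= Md -> Md <= N * d -> X - 2 * la <= m + e by lra.
  exact: arith sq az2 n1 Az lMz MM.
exists a => h.
have quad t : 0 <= t * (2 * (inner h a - l h)) + t ^+ 2 * `|h| ^+ 2.
  have := le_trans Ja (mJ (a + t *: h)).
  rewrite /J normD_sqr lD lZ normrZ exprMn real_normK ?num_real//.
  by rewrite innerZr (innerC a h); lra.
(* The value of [t] that minimizes [2 t c + t^2 (q + 1)]. *)
have := quad (- (inner h a - l h) / (`|h| ^+ 2 + 1)).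
have q0 : 0 <= `|h| ^+ 2 by exact: sqr_ge0.
set c := inner h a - l h; set q := `|h| ^+ 2.
have -> : - c / (q + 1) * (2 * c) + (- c / (q + 1)) ^+ 2 * q =
          - (c ^+ 2 * ((q + 2) / (q + 1) ^+ 2)).
  by field; rewrite gt_eqF//; rewrite /q; lra.
rewrite oppr_ge0 pmulr_lle0 ?divr_gt0 ?exprn_gt0 ?/q//; try lra.
rewrite le_eqVlt ltNge sqr_ge0 orbF sqrf_eq0 subr_eq0.
by move/eqP.
Qed.

(** A difference of closed sets need not be closed; here convexity and the
   boundedness of [B] provide compactness. Given [z] adherent to [A - B], the
   sets of points [b] of [B] such that [b + z] is almost in [A] are convex and
   decreasing, and a common adherent point [b] satisfies [b + z] in [A]. *)
Lemma closed_minkowski_sub A B r : convex A -> convex B ->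
  closed A -> closed B -> (forall x, B x -> `|x| <= r) ->
  closed (minkowski_sub A B).
Proof.
move=> cA cB clA clB Br z /closureP zAB.
pose D n := [set b | B b /\ exists2 a, A a & `|b + z - a| < n.+1%:R^-1].
have [||||b bD] := @nested_convex_closure D r.
- move=> n m nm b [Bb [a Aa ba]]; split=> //; exists a => //.
  by apply: lt_le_trans ba _; rewrite lef_pV2 ?posrE// ler_nat.
- move=> n x y t t01 [Bx [a Aa xa]] [By [b Ab yb]]; split; first exact: cB.
  exists (t *: a + (1 - t) *: b); first exact: cA.
  have -> : t *: x + (1 - t) *: y + z - (t *: a + (1 - t) *: b) =
            t *: (x + z - a) + (1 - t) *: (y + z - b).
    rewrite !scalerBr !scalerDr [RHS]addrACA -opprD; congr (_ - _).
    by rewrite [RHS]addrACA -scalerDl addrC subrKC scale1r addrC.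
  have /andP[t0 t1] := t01.
  apply: le_lt_trans (ler_normD _ _) _; rewrite !normrZ !gtr0_norm ?subr_gt0//.
  have arith (p q k : R) : p < k -> q < k -> t * p + (1 - t) * q < k by nra.
  exact: arith xa yb.
- move=> n; have [|_ [a Aa [b Bb <-]] zab] := zAB n.+1%:R^-1.
    by rewrite invr_gt0.
  exists b; split=> //; exists a => //.
  by move: zab; rewrite opprB addrCA addrA.
- by move=> n x [Bx _]; exact: Br.
have Bb : B b.
  apply/clB/closureP => e e0.
  by have [b' [Bb' _] bb'] := (closureP _ _).1 (bD 0) e e0; exists b'.
exists (b + z); last by exists b => //; rewrite addrC addKr.
apply/clA/closureP => e e0.
have e20 : 0 < e / 2 by rewrite divr_gt0.
have [b' [_ [a Aa ba]] bb'] := (closureP _ _).1 (bD (Num.truncn (2 / e))) _ e20.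
have k1 : (Num.truncn (2 / e)).+1%:R^-1 < e / 2.
  by rewrite invf_plt ?posrE// invf_div truncnS_gt.
exists a => //; apply: le_lt_trans (ler_distD (b' + z) _ _) _.
rewrite [e]splitr opprD addrACA subrr addr0; apply: ltrD => //.
exact: lt_trans ba k1.
Qed.

Lemma convex_scale0 S x t : convex S -> S 0 -> S x -> 0 < t -> t <= 1 -> S (t *: x).
Proof.
move=> cS S0 Sx t0; rewrite le_eqVlt => /predU1P[->|t1]; first by rewrite scale1r.
by have := cS _ _ _ (introT andP (conj t0 t1)) Sx S0; rewrite scaler0 addr0.
Qed.

(** Closed subspaces are barrelled. The multiples of [S] cover [V], so one of
   them contains a ball of [V] by Baire's theorem; averaging this ball with a
   point of [S] opposite to its centre recentres it at [0]. *)
Lemma absorbing_ball V S : closed V -> linear_subspace V ->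
  closed S -> convex S -> (forall z, V z -> exists2 t : R, 0 < t & S (t *: z)) ->
  exists2 r : R, 0 < r & forall z, V z -> `|z| < r -> S z.
Proof.
move=> clV [V0 VP] clS cS Sabs.
have VZ t z : V z -> V (t *: z) by move=> Vz; have := VP t z 0 Vz V0; rewrite addr0.
have S0 : S 0 by have [t _] := Sabs 0 V0; rewrite scaler0.
pose T n := [set z | S (n.+1%:R^-1 *: z)].
have clT n : closed (T n).
  move=> z /closureP zT; apply/clS/closureP => e e0.
  have [|a Ta za] := zT (e * n.+1%:R); first by rewrite mulr_gt0.
  exists (n.+1%:R^-1 *: a) => //; rewrite -scalerBr normrZ gtr0_norm ?invr_gt0//.
  by rewrite mulrC ltr_pdivrMr.
have cover z : V z -> exists n, T n z.
  move=> /Sabs[t t0 St]; exists (Num.truncn t^-1); rewrite /T /=.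
  set k := _.+1%:R; have k0 : 0 < k^-1 :> R by rewrite invr_gt0.
  have -> : k^-1 *: z = (k^-1 / t) *: (t *: z) by rewrite scalerA divfK ?gt_eqF.
  apply: convex_scale0 => //; first exact: divr_gt0.
  rewrite ler_pdivrMr// mul1r invf_ple ?posrE//.
  exact/ltW/truncnS_gt.
have [n [c [r [Vc r0 cr]]]] := closed_cover_ball clV (ex_intro _ 0 V0) clT cover.
have [t t0 St] := Sabs _ (VZ (-1) _ Vc); rewrite scaleN1r in St.
set k : R := n.+1%:R^-1; have k0 : 0 < k by rewrite invr_gt0.
have kt0 : 0 < k + t by exact: addr_gt0.
pose s := t / (k + t); have s0 : 0 < s by exact: divr_gt0.
have s1 : s < 1 by rewrite ltr_pdivrMr// mul1r ltrDr.
exists (s * k * r) => [|z Vz zr]; first exact: (mulr_gt0 (mulr_gt0 s0 k0) r0).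
have sk0 : 0 < s * k by exact: mulr_gt0.
have /cr Tz : V (c + (s * k)^-1 *: z).
  by rewrite addrC; apply: VP.
have <- : s *: (k *: (c + (s * k)^-1 *: z)) + (1 - s) *: (t *: - c) = z.
  rewrite !scalerDr !scalerA mulfV ?gt_eqF// scale1r scalerN addrAC -scalerBl.
  rewrite (_ : s * k - (1 - s) * t = 0) ?scale0r ?add0r//.
  by rewrite /s; field; rewrite gt_eqF.
apply: cS => //; first by rewrite s0 s1.
apply: Tz; rewrite addrC addKr normrZ gtr0_norm ?invr_gt0//.
by rewrite mulrC ltr_pdivrMr// mulrC.
Qed.

End hilbert.

(** * Lower semicontinuous convex functions *)

Section convex_functions.
Context {R : realType} {H : hilbertType R}.
Implicit Types (f g : H -> \bar R) (C D V : set H) (x y z w : H) (a b c e r t : R).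

Lemma econvex_le f x y a b t : econvex f -> 0 < t < 1 ->
  (f x <= a%:E)%E -> (f y <= b%:E)%E ->
  (f (t *: x + (1 - t) *: y)%R <= (t * a + (1 - t) * b)%R%:E)%E.
Proof.
move=> cf t01 fx fy; apply: le_trans (cf _ x y t01) _.
have /andP[t0 t1] := t01.
by rewrite [leRHS]EFinD !EFinM leeD// lee_wpmul2l// lee_fin ?subr_ge0 ltW.
Qed.

Lemma convex_sublevel f c : econvex f -> convex [set x | (f x <= c%:E)%E].
Proof.
move=> cf x y t t01 fx fy /=; apply: le_trans (econvex_le cf t01 fx fy) _.
by rewrite lee_fin -mulrDl subrKC mul1r.
Qed.

Lemma closed_sublevel f c :
  lower_semicontinuous f -> closed [set x | (f x <= c%:E)%E].
Proof.
move=> /lower_semicontinuousP/(_ c); rewrite -closedC.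
by congr closed; apply/seteqP; split=> x /=; rewrite leNgt => /negP.
Qed.

Lemma convex_cball x r : convex [set y | `|y - x| <= r].
Proof.
move=> y z t /andP[t0 t1] /= yx zx.
have -> : t *: y + (1 - t) *: z - x = t *: (y - x) + (1 - t) *: (z - x).
  rewrite !scalerBr [RHS]addrACA -opprD -scalerDl.
  by rewrite subrKC scale1r.
apply: le_trans (ler_normD _ _) _; rewrite !normrZ !gtr0_norm ?subr_gt0//.
have arith (p q : R) : p <= r -> q <= r -> t * p + (1 - t) * q <= r by nra.
exact: arith.
Qed.

Lemma closed_cball x r : closed [set y : H | `|y - x| <= r].
Proof.
move=> y /closureP yx /=; apply/ler_addgt0Pr => e /yx[z /= zx yz].
apply: le_trans (ler_distD z _ _) _.
by rewrite addrC lerD// ltW.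
Qed.

Lemma minkowski_sub0 D : minkowski_sub D [set 0] = D.
Proof.
apply/seteqP; split=> [_ [x Dx [_ -> <-]]|x Dx]; first by rewrite subr0.
by exists x => //; exists 0 => //; rewrite subr0.
Qed.

Lemma convex_minkowski_sub C D :
  convex C -> convex D -> convex (minkowski_sub C D).
Proof.
move=> cC cD _ _ t t01 [x Cx [y Dy <-]] [x' Cx' [y' Dy' <-]].
exists (t *: x + (1 - t) *: x'); first exact: cC.
exists (t *: y + (1 - t) *: y'); first exact: cD.
by rewrite !scalerBr opprD addrACA.
Qed.

Lemma linear_subspace_closed_span D : linear_subspace (closed_span D).
Proof.
have [W0 WP] : linear_subspace (smallest linear_subspace D).
  split=> [V [[V0 _] _]//|a x y Wx Wy V [lV DV]].
  by apply: lV.2; [exact: Wx|exact: Wy].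
split; first exact: subset_closure.
move=> a x y /closureP Wx /closureP Wy; apply/closureP => e e0.
have e20 : 0 < e / 2 by rewrite divr_gt0.
have [|x' Wx' xx'] := Wx (e / 2 / (`|a| + 1)).
  by rewrite divr_gt0// ltr_pwDr.
have [y' Wy' yy'] := Wy _ e20.
exists (a *: x' + y'); first exact: WP.
rewrite opprD addrACA -scalerBr; apply: le_lt_trans (ler_normD _ _) _.
rewrite normrZ [e]splitr; apply: ltr_leD; last exact: ltW.
move: xx'; rewrite ltr_pdivlMr ?ltr_pwDr//; apply: le_lt_trans.
by rewrite mulrC ler_wpM2l// lerDl.
Qed.

(** The set [{z | g (x + z) <= c}] is closed, convex and, [x] being interior to
   the domain, absorbing; so it is a neighbourhood of [0]. *)
Lemma interior_dom_bounded g x c : Gamma0 g -> interior (edom g) x ->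
  (g x < c%:E)%E ->
  exists2 r : R, 0 < r & forall z, `|z| < r -> (g (x + z)%R <= c%:E)%E.
Proof.
move=> [[gN _] lg cg] /nbhs_ballP[d /= d0 xd] gxc.
pose S := [set z | (g (x + z)%R <= c%:E)%E].
have [|||||r r0 Sr] := @absorbing_ball _ _ setT S.
- exact: closedT.
- by [].
- move=> z /closureP zS; apply/(closed_sublevel lg)/closureP => e /zS[y Sy zy].
  by exists (x + y) => //; rewrite opprD addrACA subrr add0r.
- move=> y z t t01 Sy Sz; have := convex_sublevel cg t01 Sy Sz.
  rewrite /S /= !scalerDr addrACA -scalerDl.
  by rewrite subrKC scale1r.
- move=> z _.
  pose u := d / 2 / (`|z| + 1).
  have u0 : 0 < u by rewrite !divr_gt0// ltr_pwDr.
  have : edom g (x + u *: z).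
    apply: xd; rewrite -ball_normE /= opprD addNKr normrN normrZ gtr0_norm//.
    rewrite mulrAC ltr_pdivrMr ?ltr_pwDr//.
    by have := normr_ge0 z; nra.
  rewrite /edom /=; have := gN (x + u *: z); have := gN x; move: gxc.
  case gx : (g x) => [a| |]//; case gz : (g _) => [b| |]// ac _ _ _.
  rewrite lte_fin in ac.
  pose s := (c - a) / (`|b - a| + (c - a) + 1).
  have den0 : 0 < `|b - a| + (c - a) + 1 by have := normr_ge0 (b - a); lra.
  have s0 : 0 < s by rewrite divr_gt0// subr_gt0.
  have s1 : s < 1 by rewrite ltr_pdivrMr//; have := normr_ge0 (b - a); lra.
  exists (s * u); first exact: mulr_gt0.
  rewrite /S /= (_ : x + _ = s *: (x + u *: z) + (1 - s) *: x); last first.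
    by rewrite scalerDr scalerA addrAC -scalerDl subrKC scale1r.
  have s01 : 0 < s < 1 by rewrite s0.
  apply: le_trans (econvex_le cg s01 (_ : _ <= b%:E)%E (_ : _ <= a%:E)%E) _.
  + by rewrite gz.
  + by rewrite gx.
  rewrite lee_fin (_ : _ + _ = a + s * (b - a)); last by ring.
  have : s * `|b - a| <= c - a.
    by rewrite mulrAC ler_pdivrMr// ler_wpM2l ?subr_ge0 ?ltW//; lra.
  have arith (p q : R) : p <= q -> s * q <= c - a -> a + s * p <= c by nra.
  exact: arith (ler_norm _).
by exists r => // z; exact: Sr.
Qed.

(** A subgradient is the linear minorant of [z |-> g (x + z) - g x], which is
   bounded above near [0]. *)
Lemma subdiff_nonempty g x : Gamma0 g -> interior (edom g) x ->
  subdiff g x !=set0.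
Proof.
move=> gG xint; have [[gN _] _ cg] := gG.
have gx_fin : g x \is a fin_num.
  by rewrite fin_numE -ltey -ltNye gN; exact: interior_subset xint.
have ltg1 : (g x < (fine (g x) + 1)%R%:E)%E.
  by rewrite -[ltLHS]fineK// lte_fin ltrDl.
have [r r0 rg] := interior_dom_bounded gG xint ltg1.
have [|||||||L [M LM] Lg] := @convex_support _ H (fun z => `|z|)
  (fun z b => g (x + z)%R <= (fine (g x) + b)%R%:E)%E 1 (r / 2).
- exact: ler_normD.
- exact: normrZ.
- by rewrite divr_gt0.
- move=> y z a b t t01 gy gz; have := econvex_le cg t01 gy gz.
  rewrite !scalerDr addrACA -scalerDl subrKC scale1r.
  by congr (_ <= _%:E)%E; ring.
- by rewrite !addr0 fineK.
- by move=> b; rewrite addr0 -[leLHS]fineK// lee_fin lerDl.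
- by move=> z b t _ _ tz; apply: rg; rewrite normrN; lra.
have [w Lw] := riesz LM.
exists w => y; rewrite -Lw -[g x]fineK//.
have := gN y; case gy : (g y) => [b| |]// _; last by rewrite leey.
rewrite -EFinD lee_fin addrC -lerBrDl; apply: Lg.
by rewrite subrKC gy lee_fin subrKC.
Qed.

(** This is the Attouch-Brezis theorem for the sum of [f] and the indicator of
   [C]. The vector [w] is a subgradient at [0] of the value function
   [v z = inf {f x | x + z in C}], finite on [C - dom f]: since
   [<y - x, w> <= f x - f x0] for all [x] and all [y] in [C], taking [y = x0] or
   [x = x0] gives the two conclusions. *)
Lemma attouch_brezis f C x0 : Gamma0 f -> closed C -> convex C ->
  sri (minkowski_sub C (edom f)) 0 -> is_minimizer f C x0 ->
  exists2 w, subdiff f x0 (- w) & forall y, C y -> inner (y - x0) w <= 0.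
Proof.
move=> [[fN _] lf cf] clC cC; rewrite /sri /= minkowski_sub0 => -[].
move=> [x1 Cx1 [x2 fx2 /eqP]]; rewrite subr_eq0 => /eqP x12.
rewrite -{x2}x12 in fx2 => coneV [Cx0 fmin].
set V := closed_span _ in coneV.
have fx0_fin : f x0 \is a fin_num.
  by rewrite fin_numE -ltey -ltNye fN; exact: le_lt_trans (fmin _ Cx1) fx2.
pose a := fine (f x0); have fx0 : f x0 = a%:E by rewrite fineK.
pose Q1 := [set x | (f x <= (a + 1)%R%:E)%E] `&` [set x | `|x - x0| <= 1].
pose Q2 := C `&` [set x | `|x - x0| <= 1].
have cQ1 : convex Q1.
  move=> x y t t01 [fx xx] [fy yy]; split; first exact: convex_sublevel.
  exact: convex_cball.
have cQ2 : convex Q2.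
  by move=> x y t t01 [Cx xx] [Cy yy]; split; [exact: cC|exact: convex_cball].
have [|||||r r0 rS] := @absorbing_ball _ _ V (minkowski_sub Q2 Q1).
- exact: closed_closure.
- exact: linear_subspace_closed_span.
- apply: (@closed_minkowski_sub _ _ _ _ (`|x0| + 1)) => //.
  + by apply: closedI => //; exact: closed_cball.
  + by apply: closedI; [exact: closed_sublevel|exact: closed_cball].
  + by move=> x [_ /= xx]; have := ler_distD x0 x 0; rewrite !subr0; lra.
- exact: convex_minkowski_sub.
- move=> z; rewrite -coneV => -[l /= l0 [_ [y Cy [x fx <-]] <-]].
  rewrite /edom /= in fx; have := fN x; move: fx.
  case fxb : (f x) => [b| |]// _ _.
  (* Moving [x] and [y] towards [x0] by the factor [D^-1] brings both within
     distance [1] of [x0], and [f x] below [a + 1]. *)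
  pose D := `|y - x0| + `|x - x0| + `|b - a| + 2.
  have [n1 [n2 n3]] : 0 <= `|y - x0| /\ 0 <= `|x - x0| /\ 0 <= `|b - a| by [].
  have D0 : 0 < D by rewrite /D; lra.
  pose t := D^-1; have t0 : 0 < t by rewrite invr_gt0.
  have t1 : t < 1 by rewrite invf_lt1// /D; lra.
  have t01 : 0 < t < 1 by rewrite t0.
  have small (u : H) : `|u - x0| <= D -> `|t *: u + (1 - t) *: x0 - x0| <= 1.
    move=> uD; rewrite (_ : _ - x0 = t *: (u - x0)).
      by rewrite normrZ gtr0_norm// mulrC ler_pdivrMr// mul1r.
    by rewrite scalerBl scale1r scalerBr addrA addrAC addrK.
  exists (t / l); first exact: divr_gt0.
  rewrite scalerA divfK ?gt_eqF//.
  exists (t *: y + (1 - t) *: x0).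
    by split; [exact: cC|apply: small; rewrite /D; lra].
  exists (t *: x + (1 - t) *: x0); last first.
    by rewrite opprD addrACA subrr addr0 -scalerBr.
  split; last by apply: small; rewrite /D; lra.
  apply: le_trans (econvex_le cf t01 (_ : _ <= b%:E)%E (_ : _ <= a%:E)%E) _.
  + by rewrite fxb.
  + by rewrite fx0.
  rewrite lee_fin [leLHS](_ : _ = a + t * (b - a)); last by ring.
  rewrite lerD2l mulrC ler_pdivrMr// mul1r; have := ler_norm (b - a).
  by rewrite /D; lra.
pose E z b := exists x y, [/\ C y, (f x <= (a + b)%R%:E)%E & z = y - x].
have EV z b : E z b -> V z.
  move=> [x [y [Cy fx ->]]]; rewrite -coneV; exists 1; first exact: ltr01.
  exists (y - x); last by rewrite scale1r.
  by exists y => //; exists x => //; apply: le_lt_trans fx _; rewrite ltry.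
have [|||||||L [M LM] LE] := @convex_support _ H (fun z => `|z|) E 1 (r / 2).
- exact: ler_normD.
- exact: normrZ.
- by rewrite divr_gt0.
- move=> _ _ b b' t t01 [x [y [Cy fx ->]]] [x' [y' [Cy' fx' ->]]].
  exists (t *: x + (1 - t) *: x'), (t *: y + (1 - t) *: y'); split.
  + exact: cC.
  + by have := econvex_le cf t01 fx fx'; congr (_ <= _%:E)%E; ring.
  + by rewrite !scalerBr opprD addrACA.
- by exists x0, x0; rewrite addr0 fx0 subrr.
- move=> b [x [y [Cy fx /esym/eqP]]]; rewrite subr_eq0 => /eqP yx.
  have := le_trans (fmin _ Cy) (_ : f y <= (a + b)%R%:E)%E.
  by rewrite yx fx0 lee_fin lerDl => /(_ fx).
- move=> z b t Ezb t0 tz.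
  have [V0 VP] : linear_subspace V := linear_subspace_closed_span _.
  have /rS[] : V (- (t *: z)).
    by rewrite -scaleNr -[_ *: _]addr0; apply: VP => //; exact: EV Ezb.
    by rewrite normrN; lra.
  by move=> y [Cy _] [x [fx _] yx]; exists x, y.
have [w Lw] := riesz LM.
exists w => [y|y Cy].
  rewrite fx0; have := fN y; case fy : (f y) => [b| |]// _; last by rewrite leey.
  have : E (x0 - y) (b - a) by exists y, x0; rewrite subrKC fy.
  move/LE; rewrite Lw -EFinD lee_fin innerNr -opprB innerNl; lra.
have : E (y - x0) 0 by exists x0, y; rewrite addr0 fx0.
by move/LE; rewrite Lw.
Qed.

End convex_functions.

(** * Systems of perturbations *)

Section multipliers.
Context {R : realType} {H : hilbertType R}.
Implicit Types (x y z w : H) (a b c e r t : R).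

(** Induction on the number of vectors. Either some [x0], orthogonal to all the
   vectors but the last, is not orthogonal to the last, and it determines the
   multiple of the last vector to subtract from [w]; or the last vector
   imposes no further condition. *)
Lemma orthogonal_span (t : nat) (u : 'I_t -> H) w :
  (forall x, (forall j, inner (u j) x = 0) -> inner w x = 0) ->
  exists beta : 'I_t -> R, w = \sum_j beta j *: u j.
Proof.
elim: t u w => [|t IH] u w uw.
  exists (fun=> 0); rewrite big_ord0; apply: inner_eq0 => y.
  by rewrite innerC; apply: uw => -[].
pose u' j := u (lift ord_max j).
have extend a :
    (exists beta : 'I_t -> R, w - a *: u ord_max = \sum_j beta j *: u' j) ->
    exists beta : 'I_t.+1 -> R, w = \sum_j beta j *: u j.
  move=> [beta /eqP]; rewrite subr_eq => /eqP ->.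
  exists (fun j => if unlift ord_max j is Some k then beta k else a).
  rewrite big_ord_recr /= unlift_none; congr (_ + _).
  apply: eq_bigr => j _.
  have -> : widen_ord (leqnSn t) j = lift ord_max j.
    by apply: val_inj; rewrite /= /bump leqNgt ltn_ord.
  by rewrite liftK.
have all_killed x : (forall j, inner (u' j) x = 0) -> inner (u ord_max) x = 0 ->
    forall j, inner (u j) x = 0.
  by move=> u'x ux j; case: (unliftP ord_max j) => [k ->|-> //]; exact: u'x.
have [[x0 [u'x0 ux0]]|no] := pselect (exists x0, (forall j, inner (u' j) x0 = 0) /\
    inner (u ord_max) x0 != 0).
  apply: (extend (inner w x0 / inner (u ord_max) x0)); apply: IH => x u'x.
  have := uw (x - (inner (u ord_max) x / inner (u ord_max) x0) *: x0).
  rewrite !innerE.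
  rewrite (_ : _ / _ * _ = inner w x0 / inner (u ord_max) x0 *
    inner (u ord_max) x); last by ring.
  apply; apply: all_killed => [j|]; first by rewrite !innerE u'x u'x0 mulr0 subrr.
  by rewrite !innerE divfK// subrr.
apply: (extend 0); rewrite scale0r subr0; apply: IH => x u'x.
apply: uw; apply: all_killed => //; apply/eqP/negPn/negP => ux.
by apply: no; exists x.
Qed.

(** The same [r] bounds the shifts [z] and gives the slack left in the
   constraint, so that it serves for both kinds of perturbations. *)
Lemma slater_ball (g : H -> \bar R) x : Gamma0 g -> interior (edom g) x ->
  (g x < 0)%E ->
  exists2 r : R, 0 < r & forall z, `|z| <= r -> (g (x + z)%R <= (- r)%R%:E)%E.
Proof.
move=> gG xint gx0; have [[gN _] _ _] := gG.
have := gN x; case gx : (g x) gx0 => [a| |]//; rewrite lte_fin => a0 _.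
have [|r r0 rg] := @interior_dom_bounded _ _ _ _ (a / 2) gG xint.
  by rewrite gx lte_fin; lra.
pose q := Num.min (r / 2) (- (a / 2)).
have q0 : 0 < q by rewrite lt_min divr_gt0//= oppr_gt0; lra.
have [q1 q2] : q <= r / 2 /\ q <= - (a / 2) by rewrite !ge_min !lexx orbT.
exists q => // z zq; apply: le_trans (rg _ _) _; first by lra.
by rewrite lee_fin; lra.
Qed.

Lemma uniform_radius (s : nat) (r : 'I_s -> R) : (forall i, 0 < r i) ->
  exists2 r0, 0 < r0 & forall i, r0 <= r i.
Proof.
move=> r0; exists (\big[Num.min/1]_i r i); last by move=> i; exact: bigmin_le.
by apply: lt_bigmin => // i _.
Qed.

Definition single {s : nat} (i : 'I_s) (p : H * R^o) : 'I_s -> (H * R^o)%type :=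
  fun j => if j == i then p else 0.

Lemma single_linear s (i : 'I_s) : linear (single i).
Proof.
move=> a p q; apply/funext => j; rewrite /single /=.
change ((if j == i then a *: p + q else 0) =
  a *: (if j == i then p else 0) + (if j == i then q else 0)).
by case: ifP => // _; rewrite scaler0 addr0.
Qed.

Lemma sum_single s (z : 'I_s -> (H * R^o)%type) : z = \sum_i single i (z i).
Proof.
apply/funext => j; rewrite fct_sumE (bigD1 j)//= /single eqxx big1 ?addr0// => i.
by rewrite eq_sym => /negPf ->.
Qed.

Lemma norm_single s (i : 'I_s) p : \sum_j `|single i p j| = `|p|.
Proof.
rewrite (bigD1 i)//= /single eqxx big1 ?addr0// => j /negPf ->.
by rewrite normr0.
Qed.

End multipliers.

(** * Normal vectors to the feasible set *)

Section normal_cone.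
Context {R : realType} {H : hilbertType R} {s t : nat}.
Context (g : 'I_s -> H -> \bar R) (u : 'I_t -> H) (eta : 'I_t -> R).
Context (gG : forall i, Gamma0 (g i)).
Implicit Types (x y z w : H) (a b c e r : R).

Lemma closed_feasible : closed (feasible g u eta).
Proof.
move=> x /closureP xF; split=> [i|j].
  have [_ lg _] := gG i; apply/(closed_sublevel lg)/closureP => e /xF[y [gy _] xy].
  by exists y => //; exact: gy.
apply/eqP; rewrite -normr_le0; apply/ler_addgt0Pr => e e0; rewrite add0r.
have uj0 : 0 < `|u j| + 1 by rewrite ltr_pwDr.
have [y [_ hy] xy] := xF _ (divr_gt0 e0 uj0).
have -> : eqconstr u eta j x = inner (u j) (x - y).
  by rewrite innerBr; move: (hy j); rewrite /eqconstr; lra.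
apply: le_trans (norm_inner_le _ _) _.
rewrite ltr_pdivlMr// in xy; apply: le_trans (ltW xy).
by rewrite mulrC ler_wpM2l// lerDl.
Qed.

Lemma convex_feasible : convex (feasible g u eta).
Proof.
move=> x y r r01 [gx hx] [gy hy]; split=> [i|j].
  have [_ _ cg] := gG i; exact: (convex_sublevel cg r01 (gx i) (gy i)).
move: (hx j) (hy j); rewrite /eqconstr !innerE => h1 h2.
rewrite (_ : _ - _ = r * (inner (u j) x - eta j) +
  (1 - r) * (inner (u j) y - eta j)); last by ring.
by rewrite h1 h2 !mulr0 addr0.
Qed.

(** The vector [w] is normal to the feasible set at [x] when [x] maximizes
   [<., w>] over this set. The multipliers come from a linear minorant of the
   value function of this problem; only the inequality constraints are
   perturbed, since the equality constraints define an affine subspace of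
   finite codimension whose normals are known. *)
Lemma normal_cone_feasible x0 x w :
  (forall i, lev_le0 (g i) `<=` interior (edom (g i))) ->
  (forall i, (g i x0 < 0)%E) -> (forall j, eqconstr u eta j x0 = 0) ->
  feasible g u eta x ->
  (forall y, feasible g u eta y -> inner (y - x) w <= 0) ->
  exists (lam : 'I_s -> R) (v : 'I_s -> H) (beta : 'I_t -> R),
    [/\ forall i, 0 <= lam i, forall i, subdiff (g i) x (v i),
        forall i, ((lam i)%:E * g i x = 0)%E &
        w = \sum_i lam i *: v i + \sum_j beta j *: u j].
Proof.
move=> g_lev gx0 hx0 [gx hx] wx.
have gi_fin i : g i x \is a fin_num.
  have [[gN _] _ _] := gG i; rewrite fin_numE -ltey -ltNye gN.
  exact: le_lt_trans (gx i) (ltry 0).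
pose ga i := fine (g i x); have gaE i : g i x = (ga i)%:E by rewrite fineK.
have ga_le0 i : ga i <= 0 by have := gx i; rewrite gaE lee_fin.
have xint i : interior (edom (g i)) x by exact/g_lev/gx.
have ball i : exists r, 0 < r /\
    forall z, `|z| <= r -> (g i (x0 + z)%R <= (- r)%R%:E)%E.
  have [|r r0 rg] := slater_ball (gG i) _ (gx0 i); last by exists r.
  exact/g_lev/ltW/gx0.
pose rho i := sval (cid (ball i)).
have rhoP i : 0 < rho i /\ forall z, `|z| <= rho i ->
  (g i (x0 + z)%R <= (- rho i)%R%:E)%E by exact: svalP (cid (ball i)).
have [r r0 rrho] := uniform_radius (fun i => (rhoP i).1).
pose V : lmodType R := 'I_s -> (H * R^o)%type.
pose nu (z : V) : R := \sum_i `|z i|.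
have nu_ge i (z : V) : `|(z i).1| <= nu z /\ `|(z i).2| <= nu z.
  have : `|z i| <= nu z by rewrite /nu (bigD1 i)//= lerDl sumr_ge0.
  by rewrite prod_normE ge_max => /andP[].
(* A perturbation [z] shifts the argument of the [i]-th inequality constraint
   by [(z i).1] and relaxes its right-hand side to [(z i).2]; the equality
   constraints are kept. *)
pose E (z : V) b := exists y, [/\ forall j, eqconstr u eta j y = 0,
  forall i, (g i (y + (z i).1)%R <= ((z i).2)%:E)%E & - inner (y - x) w <= b].
have [|||||||L [M LM] LE] := @convex_support _ V nu E (- inner (x0 - x) w) r.
- move=> y z; rewrite /nu -big_split; apply: ler_sum => i _; exact: ler_normD.
- by move=> a z; rewrite /nu mulr_sumr; apply: eq_bigr => i _; exact: normrZ.
- exact: r0.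
- move=> z z' b b' a a01 [y [hy gy yb]] [y' [hy' gy' yb']].
  exists (a *: y + (1 - a) *: y'); split.
  + move=> j; move: (hy j) (hy' j); rewrite /eqconstr !innerE => h1 h2.
    rewrite (_ : _ - _ = a * (inner (u j) y - eta j) +
      (1 - a) * (inner (u j) y' - eta j)); last by ring.
    by rewrite h1 h2 !mulr0 addr0.
  + move=> i; have [_ _ cg] := gG i; have := econvex_le cg a01 (gy i) (gy' i).
    by rewrite !scalerDr addrACA.
  + have /andP[a0 a1] := a01; move: yb yb'.
    rewrite !innerE => h1 h2; nra.
- exists x; split=> // [i|]; first by rewrite addr0.
  by rewrite subrr inner0l oppr0.
- move=> b [y [hy gy yb]]; apply: le_trans yb; rewrite oppr_ge0; apply: wx.
  by split=> // i; have := gy i; rewrite addr0.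
- move=> z b a _ a0 zr; exists x0; split=> // i.
  have [z1 z2] := nu_ge i (a *: z).
  apply: le_trans ((rhoP i).2 _ _) _.
    by rewrite normrN; apply: le_trans z1 _; apply: le_trans zr _.
  rewrite lee_fin lerN2; apply: le_trans (ler_norm _) _; apply: le_trans z2 _.
  exact: le_trans zr _.
have LZ i p : L (single i p) = L (single i (p.1, 0)) + p.2 * L (single i (0, 1)).
  rewrite addrC -[_ * L _]/(_ *: L _) -linearP -single_linear.
  congr (L (single i _)).
  case: p => y b; rewrite -[RHS]/(b *: (0 : H) + y, b * 1 + 0).
  by rewrite scaler0 add0r mulr1 addr0.
pose lam i := - L (single i (0, 1)).
have [W LW] : exists W : 'I_s -> H, forall i z, L (single i (z, 0)) = inner z (W i).
  have hW i : exists w', forall z, L (single i (z, 0)) = inner z w'.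
    pose l (z : H) : R^o := L (single i (z, 0)).
    have ll : linear l.
      move=> a y z; rewrite /l -linearP -single_linear.
      by rewrite -[X in _ = L (single i X)]/(a *: y + z, a * 0 + 0) mulr0 addr0.
    pose ll' := GRing.isLinear.Build R H R^o *:%R l ll.
    pose l' : {linear H -> R^o} := HB.pack l ll'.
    apply: (@riesz _ _ l' M) => z; apply: le_trans (LM _) _.
    by rewrite /nu norm_single prod_normE normr0 max_l.
  by exists (fun i => sval (cid (hW i))) => i; exact: svalP (cid (hW i)).
have Ldec (z : V) : L z = \sum_i (inner (z i).1 (W i) - (z i).2 * lam i).
  rewrite {1}[z]sum_single linear_sum; apply: eq_bigr => i _.
  by rewrite LZ LW /lam mulrN opprK.
(* Perturb only the [i]-th constraint and test it at [x]. *)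
have E1 i z b : (g i (x + z)%R <= b%:E)%E -> inner z (W i) <= b * lam i.
  move=> gb; rewrite -subr_le0 -LW /lam mulrN opprK -(LZ i (z, b)).
  apply: LE; exists x; split=> // [k|]; last by rewrite subrr inner0l oppr0.
  by rewrite /single; case: eqP => [->//|_]; rewrite addr0.
have lam0 i : 0 <= lam i.
  have := E1 i 0 1; rewrite inner0l mul1r; apply.
  by rewrite addr0; apply: le_trans (gx i) _; rewrite lee_fin.
have lamga i : lam i * ga i = 0.
  apply/eqP; rewrite eq_le mulr_ge0_le0//=.
  by have := E1 i 0 (ga i); rewrite inner0l addr0 mulrC => ->//; rewrite gaE.
have WV i : exists v, subdiff (g i) x v /\ W i = lam i *: v.
  have := lam0 i; rewrite le_eqVlt => /predU1P[l0|l0].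
    (* Then [W i = 0], as the form [<., W i>] is nonpositive near [0]. *)
    have [v gv] := subdiff_nonempty (gG i) (xint i).
    exists v; split=> //; rewrite -l0 scale0r; apply: inner_eq0 => y.
    have gi1 : (g i x < (ga i + 1)%R%:E)%E by rewrite gaE lte_fin ltrDl.
    have [q q0 gq] := interior_dom_bounded (gG i) (xint i) gi1.
    pose k := q / 2 / (`|y| + 1).
    have k0 : 0 < k by rewrite !divr_gt0// ltr_pwDr.
    have kq : `|k *: y| < q.
      rewrite normrZ gtr0_norm// mulrAC ltr_pdivrMr ?ltr_pwDr//.
      by have := normr_ge0 y; nra.
    have := E1 i _ _ (gq _ kq); rewrite -l0 mulr0 innerZl pmulr_rle0// => h1.
    have := kq; rewrite -normrN => /gq/(E1 i).
    rewrite -l0 mulr0 innerNl innerZl oppr_le0 pmulr_rge0// => h2.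
    by apply/eqP; rewrite eq_le h1.
  exists ((lam i)^-1 *: W i); split; last by rewrite scalerA mulfV ?gt_eqF// scale1r.
  move=> y; have [[gN _] _ _] := gG i.
  have := gN y; case gy : (g i y) => [b| |]// _; last by rewrite leey.
  have := lamga i => /eqP; rewrite mulf_eq0 gt_eqF//= => /eqP ga0.
  rewrite gaE ga0 adde0 lee_fin innerZr mulrC ler_pdivrMr//.
  by apply: E1; rewrite subrKC gy.
pose v i := sval (cid (WV i)).
have vP i : subdiff (g i) x (v i) /\ W i = lam i *: v i by exact: svalP (cid (WV i)).
have [beta wb] : exists beta : 'I_t -> R, w - \sum_i W i = \sum_j beta j *: u j.
  apply: orthogonal_span => k uk.
  have key a : a * inner (w - \sum_i W i) k <= 0.
    (* Move to [x + a *: k] and shift every inequality constraint back to [x]. *)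
    have : L (fun i => (- (a *: k), ga i)) <= - inner (x + a *: k - x) w.
      apply: LE; exists (x + a *: k); split=> //=.
        by move=> j; rewrite /eqconstr !innerE uk mulr0 addr0; exact: hx.
      by move=> i; rewrite addrK gaE.
    rewrite Ldec /= (eq_bigr (fun i => - (a * inner k (W i)))) => [|i _]; last first.
      by rewrite (mulrC (ga i)) lamga subr0 innerNl innerZl.
    rewrite sumrN -mulr_sumr addrAC subrr add0r innerZl innerBl.
    rewrite (innerC w) (innerC _ k).
    rewrite inner_sumr; lra.
  by have := key 1; have := key (-1); rewrite mul1r mulN1r; lra.
exists lam, v, beta; split=> //.
- by move=> i; exact: (vP i).1.
- by move=> i; rewrite gaE -EFinM lamga.
- rewrite -wb (eq_bigr W) ?subrKC// => i _.
  by rewrite (vP i).2.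
Qed.

End normal_cone.

(** * Saddle points of the Lagrangian *)

Section saddle.
Context {R : realType} {H : hilbertType R} {s t : nat}.
Context (f : H -> \bar R) (g : 'I_s -> H -> \bar R).
Context (u : 'I_t -> H) (eta : 'I_t -> R).
Implicit Types (x y z w : H) (a b c e r : R).

Context (fP : eproper f) (gP : forall i, eproper (g i)).

Lemma subdiff_fin (h : H -> \bar R) x w :
  eproper h -> subdiff h x w -> h x \is a fin_num.
Proof.
move=> [hN [y hy]] /(_ y); rewrite fin_numE -ltey -ltNye hN /= => le.
rewrite ltey; apply/eqP => hx.
by move: (le_lt_trans le hy); rewrite hx addey// ltxx.
Qed.

Lemma lagrangian_solution x lam beta : complementary g u eta x lam ->
  lagrangian f g u eta x lam beta = f x.
Proof.
move=> [gl hx]; rewrite /lagrangian big1 => [|i _]; last exact: (gl i).2.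
by rewrite big1 ?adde0// => j _; rewrite hx mulr0.
Qed.

Lemma lagrangian_le x lam beta : (forall i, 0 <= lam i) -> feasible g u eta x ->
  (lagrangian f g u eta x lam beta <= f x)%E.
Proof.
move=> lam0 [gx hx]; rewrite /lagrangian [X in (_ + X)%E]big1 => [|j _]; last first.
  by rewrite hx mulr0.
rewrite adde0 -[leRHS]adde0 leeD2l//; apply: sume_le0 => i _.
by apply: mule_ge0_le0; rewrite ?lee_fin.
Qed.

(** Adding the subgradient inequalities of [f] and of the [g i], the latter
   weighted by [lam i], the linear terms cancel out. *)
Lemma KKT_lagrangian_ge x lam v beta y : KKT f g u eta x lam v beta ->
  (f x <= lagrangian f g u eta y lam beta)%E.
Proof.
move=> [lam0 gv fw [gl hx]].
set w := - _ - _ in fw.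
have fx_fin := subdiff_fin fP fw.
have gx_fin i := subdiff_fin (gP i) (gv i).
have gi i : ((lam i * inner (y - x) (v i))%:E <= (lam i)%:E * g i y)%E.
  have := gv i y => /(lee_wpmul2l (_ : 0 <= (lam i)%:E)%E); rewrite lee_fin.
  move=> /(_ (lam0 i)).
  by rewrite muleDr// ?(gl i).2 ?adde0 ?EFinM// fin_num_adde_defl.
have hj j : beta j * eqconstr u eta j y = inner (y - x) (beta j *: u j).
  rewrite innerZr innerC innerBr; move: (hx j); rewrite /eqconstr => /eqP.
  by rewrite subr_eq0 => /eqP ->.
have -> : f x = (inner (y - x) w)%:E + f x +
    \sum_i (lam i * inner (y - x) (v i))%:E +
    \sum_j (beta j * eqconstr u eta j y)%:E :> \bar R.
  rewrite !sumEFin (eq_bigr _ (fun j _ => hj j)) -inner_sumr.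
  rewrite (eq_bigr (fun i => inner (y - x) (lam i *: v i))) => [|i _]; last first.
    by rewrite innerZr.
  rewrite -inner_sumr /w -[f x]fineK// -!EFinD !innerE; congr (_%:E); ring.
by rewrite /lagrangian leeD2r// leeD//; apply: lee_sum => i _; exact: gi.
Qed.

Lemma KKT_saddle x lam v beta : KKT f g u eta x lam v beta ->
  lagrange_multipliers f g u eta x lam beta /\
  is_minimizer (fun y => lagrangian f g u eta y lam beta) setT x.
Proof.
move=> K; have [lam0 gv fw comp] := K.
have ge y := KKT_lagrangian_ge y K.
have xF : feasible g u eta x by split=> [i|j]; [exact: (comp.1 i).1|exact: comp.2].
have eq := lagrangian_solution beta comp.
split; last by split=> // y _; rewrite eq.
by split=> // y lam' beta' lam'0; rewrite eq; split=> //; exact: lagrangian_le.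
Qed.

Lemma KKT_minimizer x lam v beta : KKT f g u eta x lam v beta ->
  is_minimizer f (feasible g u eta) x.
Proof.
move=> K; have [lam0 _ _ comp] := K; split.
  by split=> [i|j]; [exact: (comp.1 i).1|exact: comp.2].
by move=> y yF; apply: le_trans (KKT_lagrangian_ge y K) (lagrangian_le _ _ yF).
Qed.

End saddle.

(** * Gateaux gradients *)

Section gateaux.
Context {R : realType} {H : hilbertType R}.
Implicit Types (f : H -> \bar R) (x y z w : H) (a b c e r : R).

(** A continuous linear derivative is bounded, so by [riesz] it has the
   representer that [gradient] chooses. *)
Lemma gradientP f x : gateaux_differentiable f x ->
  is_directional_derivative f x (fun y => inner y (gradient f x)).
Proof.
move=> [D [Dc Df]].
have [M DM] : exists M, forall y, D y <= M * `|y|.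
  have /cvgrPdist_lt/(_ 1 ltr01)/nbhs_ballP[d /= d0 Dd] := Dc 0.
  exists (2 / d) => y; have [->|y0] := eqVneq y 0.
    by rewrite linear0 normr0 mulr0.
  have yp : 0 < `|y| by rewrite normr_gt0.
  pose k := d / 2 / `|y|; have k0 : 0 < k by rewrite !divr_gt0.
  have := Dd (k *: y).
  rewrite -ball_normE /= sub0r normrN normrZ gtr0_norm// divfK ?gt_eqF//.
  have Dk : D (k *: y) = k * D y by rewrite linearZ.
  rewrite linear0 sub0r normrN Dk => /(_ ltac:(lra))/ltW/(le_trans (ler_norm _)).
  rewrite mulrC -ler_pdivlMr// => h.
  by apply: le_trans h _; rewrite /k div1r !invf_div mulrC.
have [w Dw] := riesz DM.
rewrite /gradient; case: xgetP => [z _ //|/(_ w)[]].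
rewrite /=; suff <- : D = (fun y => inner y w) :> (H -> R) by [].
exact/funext.
Qed.

Lemma directional_derivative_le f x y (D : H -> R) c :
  is_directional_derivative f x D ->
  (forall a, 0 < a < 1 -> ((f (x + a *: y)%R - f x) * (a^-1)%:E <= c%:E)%E) ->
  D y <= c.
Proof.
move=> [_ /(_ y) Dy] le; rewrite -lee_fin -(cvg_lim _ Dy)//.
apply: lime_le; first by apply/cvg_ex; exists (D y)%:E.
near=> a; apply: le; apply/andP; split; near: a.
- exact: nbhs_right_gt.
- exact: nbhs_right_lt.
Unshelve. all: by end_near. Qed.

Lemma directional_derivative_ge f x y (D : H -> R) c :
  is_directional_derivative f x D ->
  (forall a, 0 < a < 1 -> (c%:E <= (f (x + a *: y)%R - f x) * (a^-1)%:E)%E) ->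
  c <= D y.
Proof.
move=> [_ /(_ y) Dy] le; rewrite -lee_fin -(cvg_lim _ Dy)//.
apply: lime_ge; first by apply/cvg_ex; exists (D y)%:E.
near=> a; apply: le; apply/andP; split; near: a.
- exact: nbhs_right_gt.
- exact: nbhs_right_lt.
Unshelve. all: by end_near. Qed.

(** By convexity the difference quotients in the direction [y - x] are at most
   [f y - f x]. *)
Lemma subdiff_directional_derivative f x w : Gamma0 f ->
  is_directional_derivative f x (fun y => inner y w) -> subdiff f x w.
Proof.
move=> [[fN _] _ cf] df y; have [fx_fin _] := df.
have fx := fineK fx_fin; rewrite -fx.
have := fN y; case fy : (f y) => [b| |]// _; last by rewrite leey.
rewrite -EFinD lee_fin -lerBrDr; apply: (directional_derivative_le df) => a a01.
have /andP[a0 a1] := a01.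
rewrite lee_pdivrMr// -fx leeBlDr// -EFinM -EFinD.
have -> : x + a *: (y - x) = a *: y + (1 - a) *: x.
  by rewrite scalerBr scalerBl scale1r addrCA.
apply: le_trans (econvex_le cf a01 (_ : _ <= b%:E)%E (_ : _ <= (fine (f x))%:E)%E) _.
- by rewrite fy.
- by rewrite fx.
by rewrite lee_fin; lra.
Qed.

(** A subgradient [v] bounds the difference quotients below, so that
   [<., v> <= <., w>]; two linear forms so ordered are equal. *)
Lemma subdiff_unique f x v w : subdiff f x v ->
  is_directional_derivative f x (fun y => inner y w) -> v = w.
Proof.
move=> fv df; have [fx_fin _] := df.
have le y : inner y v <= inner y w.
  apply: (directional_derivative_ge df) => a /andP[a0 a1].
  rewrite lee_pdivlMr// leeBrDr//.
  have := fv (x + a *: y); rewrite addrAC subrr add0r innerZl.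
  by rewrite mulrC.
apply/eqP; rewrite -subr_eq0; apply/eqP/inner_eq0 => y.
have := le y; have := le (- y); rewrite !innerE; lra.
Qed.

End gateaux.

(** * The Karush-Kuhn-Tucker theorem *)

Theorem theorem5p2 (R : realType) (H : hilbertType R) (s t : nat)
    (s_gt0 : (0 < s)%N) (t_gt0 : (0 < t)%N) (xbar : H)
    (f : H -> \bar R) (g : 'I_s -> H -> \bar R)
    (u : 'I_t -> H) (eta : 'I_t -> R)
    (f_Gamma0 : Gamma0 f) (g_Gamma0 : forall i, Gamma0 (g i))
    (g_lev : forall i, lev_le0 (g i) `<=` interior (edom (g i)))
    (slater : (\bigcap_i lev_lt0 (g i)) `&` (\bigcap_j ker_eqconstr u eta j)
              !=set0)
    (qualif : sri (minkowski_sub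
                     ((\bigcap_i lev_le0 (g i)) `&`
                      (\bigcap_j ker_eqconstr u eta j))
                     (edom f)) 0) :
  [/\ is_minimizer f (feasible g u eta) xbar <->
        (exists lam v beta, KKT f g u eta xbar lam v beta),
      forall lam v beta, KKT f g u eta xbar lam v beta ->
        lagrange_multipliers f g u eta xbar lam beta /\
        is_minimizer (fun x => lagrangian f g u eta x lam beta) setT xbar &
      gateaux_differentiable f xbar ->
      (forall i, gateaux_differentiable (g i) xbar) ->
      (exists lam v beta, KKT f g u eta xbar lam v beta) <->
      (exists lam beta, smooth_KKT f g u eta xbar lam beta)].
Proof.
have [fP _ _] := f_Gamma0.
have gP i : eproper (g i) by have [] := g_Gamma0 i.
split.
- split=> [xmin|[lam [v [beta K]]]]; last exact: KKT_minimizer K.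
  have feasE : (\bigcap_i lev_le0 (g i)) `&` (\bigcap_j ker_eqconstr u eta j) =
               feasible g u eta.
    apply/seteqP; split=> x [gx hx]; split=> i; [exact: gx|exact: hx|..].
      by move=> _; exact: gx.
    by move=> _; exact: hx.
  rewrite feasE in qualif.
  have [w fw Nw] := attouch_brezis f_Gamma0 (closed_feasible g_Gamma0)
    (convex_feasible g_Gamma0) qualif xmin.
  have [x0 [gx0 hx0]] := slater.
  have [lam [v [beta [lam0 gv lamg wE]]]] := normal_cone_feasible g_Gamma0 g_lev
    (fun i => gx0 i I) (fun j => hx0 j I) xmin.1 Nw.
  exists lam, v, beta; split=> //; first by rewrite -opprD -wE.
  by split=> [i|j]; [split; [exact: xmin.1.1|exact: lamg]|exact: xmin.1.2].
- by move=> lam v beta K; exact: KKT_saddle K.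
- move=> /gradientP df dg'; have dg i := gradientP (dg' i).
  split=> [[lam [v [beta [lam0 gv fw comp]]]]|[lam [beta [lam0 grad0 comp]]]].
    exists lam, beta; split=> //; rewrite -(subdiff_unique fw df).
    have -> : \sum_i lam i *: gradient (g i) xbar = \sum_i lam i *: v i.
      by apply: eq_bigr => i _; rewrite (subdiff_unique (gv i) (dg i)).
    by rewrite -opprD -addrA addNr.
  exists lam, (fun i => gradient (g i) xbar), beta; split=> // [i|].
    exact: subdiff_directional_derivative.
  rewrite (_ : _ - _ = gradient f xbar); first exact: subdiff_directional_derivative.
  by apply/esym/eqP; rewrite -opprD -addr_eq0 addrA; apply/eqP.
Qed.
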